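(* Let $G$ be a finite nilpotent group such that $\mathrm{diam}(\Gamma_1(G))>2$. Then $\mathrm{diam}(\Gamma_1(G))=4$.
   Context: For a finite group $G$, $\Gamma_1(G)$ is the undirected graph with vertex set $G\setminus\{1\}$, in which two distinct vertices $x,y$ are adjacent if and only if one of them is a power of the other. For a graph $L$ with vertex set $V(L)$ and any two vertices $x,y$ of $L$, $d(x,y)$ denotes the length of a smallest path between $x$ and $y$, and $\mathrm{diam}(L)=\max\{d(x,y)\mid x,y\in V(L)\}$.
   Formalization: The diameter is taken as the maximum of d(x,y) over pairs of vertices joined by a path, since d is undefined for unjoined vertices (with d infinite the claim fails, e.g. for Z_2 x Z_2); for connected graphs this is the usual diameter. *)

(* Defs.v *)
From mathcomp Require Import all_boot all_fingroup all_solvable.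

Set Implicit Arguments.
Unset Strict Implicit.
Unset Printing Implicit Defensive.

Import GroupScope.

Section Graph.

Variables (V : finType) (e : rel V).

Definition has_path_of_length (x y : V) (n : nat) : bool :=
  [exists p : n.-tuple V, [&& path e x p, last x p == y & uniq (x :: p)]].

(* A path has pairwise distinct vertices, hence fewer than #|V| edges, so the
   search range contains the length of every path. The value is junk (#|V|)
   when x and y are not joined by a path. *)
Definition dist (x y : V) : nat :=
  find (has_path_of_length x y) (iota 0 #|V|).

(* d(x, y) is defined only for vertices joined by a path, so the maximum is
   taken over those pairs; the diameter of the empty graph is 0. *)
Definition diam : nat := \max_(x : V) \max_(y : V | connect e x y) dist x y.

Lemma has_path_of_lengthP x y n :
  reflect (exists p : seq V,
             [/\ path e x p, last x p = y, uniq (x :: p) & size p = n])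
          (has_path_of_length x y n).
Proof.
apply: (iffP existsP) => [[p /and3P[ep /eqP lp up]]|[p [ep lp up sp]]].
  by exists p; rewrite size_tuple.
have sp' : size p == n by apply/eqP.
by exists (Tuple sp'); rewrite /= ep lp eqxx.
Qed.

Lemma has_path_of_length_lt x y n : has_path_of_length x y n -> n < #|V|.
Proof.
case/has_path_of_lengthP=> p [_ _ up <-].
by have := card_uniqP up => /= <-; apply: max_card.
Qed.

Lemma connect_has_path x y :
  reflect (exists n, has_path_of_length x y n) (connect e x y).
Proof.
apply: (iffP connectP) => [[p ep ->]|[n /has_path_of_lengthP[p [ep <- _ _]]]].
  case/shortenP: ep => q eq uq _; exists (size q).
  by apply/has_path_of_lengthP; exists q.
by exists p.
Qed.

Lemma dist_min x y n : has_path_of_length x y n -> dist x y <= n.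
Proof.
move=> xyn; have n_lt := has_path_of_length_lt xyn.
rewrite leqNgt; apply/negP => /(before_find 0).
by rewrite nth_iota // add0n xyn.
Qed.

Lemma dist_path x y : connect e x y -> has_path_of_length x y (dist x y).
Proof.
case/connect_has_path=> n xyn; have n_lt := has_path_of_length_lt xyn.
have hasP : has (has_path_of_length x y) (iota 0 #|V|).
  by apply/hasP; exists n; rewrite ?mem_iota.
have := nth_find 0 hasP; rewrite nth_iota ?add0n //.
by move: hasP; rewrite has_find size_iota.
Qed.

End Graph.

Section PowerGraph.

Variable gT : finGroupType.

Definition is_power_of (x y : gT) : bool := [exists n : 'I_#[y], x == y ^+ n].

Lemma is_power_ofP x y : reflect (exists n : nat, x = y ^+ n) (is_power_of x y).
Proof.
apply: (iffP existsP) => [[n /eqP->]|[n ->]]; first by exists n.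
exists (Ordinal (ltn_pmod n (order_gt0 y))).
by rewrite /= expg_mod_order.
Qed.

Definition Gamma1_vertex (G : {group gT}) : finType := {x : gT | x \in G^#}.

Definition Gamma1 (G : {group gT}) : rel (Gamma1_vertex G) :=
  fun x y => (x != y) && (is_power_of (val x) (val y) || is_power_of (val y) (val x)).

End PowerGraph.

(* Main.v *)
Require Import Defs.
From mathcomp Require Import all_boot all_fingroup all_solvable.

(** In a nilpotent group, elements [x], [y] of coprime orders are both powers of
    [x * y]. If for every prime [p] there is at most one subgroup of order [p],
    then two elements either share a power of prime order or have coprime orders,
    so the diameter is at most 2. The same bound holds for [p]-groups, because a
    connected component consists of the elements having a given subgroup of order
    [p] among their powers. In the remaining case two prime divisors are available,
    which yields walks of length 4 between any two vertices; and generators [u],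
    [v] of two distinct subgroups of the same prime order are at distance at least
    4, since a shorter path would put [u] and [v] in a common cyclic group. *)

Set Implicit Arguments.
Unset Strict Implicit.
Unset Printing Implicit Defensive.

Import GroupScope.

(** [dist] only counts duplicate-free paths; removing the loops of a walk never lengthens it. *)
Lemma dist_path_le (V : finType) (e : rel V) (x : V) (p : seq V) :
  path e x p -> dist e x (last x p) <= size p.
Proof.
case/shortenP=> q eq uq sub_qp; apply: (@leq_trans (size q)).
  by apply: dist_min; apply/has_path_of_lengthP; exists q.
by apply: uniq_leq_size => //; case/andP: uq.
Qed.

Lemma diam_leq (V : finType) (e : rel V) n :
  (forall x y, connect e x y -> dist e x y <= n) -> diam e <= n.
Proof.
by move=> le_n; apply/bigmax_leqP=> x _; apply/bigmax_leqP=> y; apply: le_n.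
Qed.

Lemma dist_leq_diam (V : finType) (e : rel V) (x y : V) :
  connect e x y -> dist e x y <= diam e.
Proof.
move=> xy; apply: leq_trans (leq_bigmax x).
exact: (@leq_bigmax_cond _ (connect e x) (dist e x)).
Qed.

(** * Powers and cyclic subgroups *)

Section PowerRelation.

Variable gT : finGroupType.
Implicit Types (x y u v w : gT) (G : {group gT}).

(** Adjacency without the distinctness clause; being reflexive, it allows walks that stand still. *)
Definition cycle_cmp x y := (x \in <[y]>) || (y \in <[x]>).

Lemma cycle_cmpC x y : cycle_cmp x y = cycle_cmp y x.
Proof. exact: orbC. Qed.

Lemma is_power_of_cycle x y : is_power_of x y = (x \in <[y]>).
Proof. by apply/is_power_ofP/cycleP. Qed.

Lemma Gamma1E G (x y : Gamma1_vertex G) :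
  Gamma1 x y = (x != y) && cycle_cmp (val x) (val y).
Proof. by rewrite /Gamma1 !is_power_of_cycle. Qed.

Lemma eq_cycle_order u v w :
  u \in <[w]> -> v \in <[w]> -> #[u] = #[v] -> <[u]> = <[v]>.
Proof.
rewrite -!cycle_subG => uw vw uv; apply/eqP.
by rewrite (eq_subG_cyclic (cycle_cyclic w) uw vw) -!orderE uv.
Qed.

(** Cauchy gives an element of order [#[u]] in [<[y]>]; the cyclic group [<[x]>] has only one
    subgroup of that order. *)
Lemma prime_order_mem_cycle u x y :
    u \in <[x]> -> y \in <[x]> -> prime #[u] -> #[u] %| #[y] ->
  u \in <[y]>.
Proof.
move=> ux yx pr_u dvd_uy; have [v vy ov] := Cauchy pr_u dvd_uy.
have vx : v \in <[x]> by apply: subsetP vy; rewrite cycle_subG.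
rewrite -cycle_subG (eq_cycle_order ux vx) ?cycle_subG //.
Qed.

Lemma prime_order_neighbour u x :
  prime #[u] -> x != 1 -> cycle_cmp u x -> u \in <[x]>.
Proof.
move=> pr_u nx1 /orP[// | xu]; apply: (prime_order_mem_cycle (cycle_id u)) => //.
have : #[x] %| #[u] by apply: order_dvdG.
by move/(prime_nt_dvdP pr_u)=> -> //; rewrite order_eq1.
Qed.

(** Subgroups of coprime orders centralise each other in a nilpotent group, so [<[x * y]>] is the
    product of [<[x]>] and [<[y]>]. *)
Lemma coprime_cycleM G x y :
    nilpotent G -> x \in G -> y \in G -> coprime #[x] #[y] ->
  x \in <[x * y]> /\ y \in <[x * y]>.
Proof.
move=> nilG Gx Gy co_xy.
have cxy : commute x y.
  have sub_cyc z : z \in G -> <[z]> \subset G by rewrite cycle_subG.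
  have := sub_nilpotent_cent2 nilG (sub_cyc x Gx) (sub_cyc y Gy) co_xy.
  by rewrite cycle_subG /= cent_cycle => /cent1P.
rewrite cycleM //; split.
  by rewrite -[X in X \in _]mulg1 mem_mulg ?cycle_id ?group1.
by rewrite -[X in X \in _]mul1g mem_mulg ?cycle_id ?group1.
Qed.

Lemma cycle_neq1 x y : x \in <[y]> -> x != 1 -> y != 1.
Proof. by move=> xy; apply: contraNneq => y1; rewrite y1 cycle1 inE in xy. Qed.

Lemma prime_order_neq1 x : prime #[x] -> x != 1.
Proof. by rewrite -order_eq1; case: eqP => // ->. Qed.

Lemma prime_power x p :
  prime p -> p %| #[x] -> exists2 u, u \in <[x]> & #[u] = p.
Proof. by move=> pr_p /(Cauchy pr_p)[u ux ou]; exists u. Qed.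

Lemma pdiv_order_prime x : x != 1 -> prime (pdiv #[x]).
Proof. by move=> nx1; rewrite pdiv_prime // order_gt1. Qed.

(** Lets explicit walks be listed as group elements without checking that consecutive ones differ:
    repetitions are dropped. *)
Lemma Gamma1_walk G (x y : Gamma1_vertex G) (s : seq gT) :
    all (mem G^#) s -> path cycle_cmp (val x) s -> last (val x) s = val y ->
  connect (@Gamma1 gT G) x y /\ dist (@Gamma1 gT G) x y <= size s.
Proof.
move=> Gs xs last_s.
suff [p [xp last_p le_ps]] : exists p : seq (Gamma1_vertex G),
    [/\ path (@Gamma1 gT G) x p, last x p = y & size p <= size s].
  split; first by apply/connectP; exists p.
  by rewrite -last_p; apply: leq_trans (dist_path_le xp) le_ps.
elim: s x Gs xs last_s => [|a s IHs] x /=; first by move=> _ _ /val_inj; exists [::].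
case/andP=> Ga Gs /andP[xa a_s] last_s.
have [p [ap last_p le_ps]] := IHs (Sub a Ga : Gamma1_vertex G) Gs a_s last_s.
have [eq_xa | neq_xa] := eqVneq x (Sub a Ga).
  by exists p; rewrite eq_xa; split=> //; apply: leqW.
by exists (Sub a Ga :: p); split=> //=; rewrite Gamma1E neq_xa xa.
Qed.

Lemma dist_common_power G (x y : Gamma1_vertex G) u :
  u != 1 -> u \in <[val x]> -> u \in <[val y]> -> dist (@Gamma1 gT G) x y <= 2.
Proof.
move=> nu1 ux uy; have /setD1P[_ Gx] := valP x.
have Gu : u \in G by apply: subsetP ux; rewrite cycle_subG.
apply: (proj2 (@Gamma1_walk G x y [:: u; val y] _ _ _)) => //=.
  by rewrite !inE nu1 Gu -in_setD1 (valP y).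
by rewrite /cycle_cmp ux uy orbT.
Qed.

(** * Cases of diameter at most 2 *)

Lemma diam_Gamma1_unique_prime_subgroups G :
    nilpotent G ->
    {in G &, forall u v, prime #[u] -> #[u] = #[v] -> <[u]> = <[v]>} ->
  diam (@Gamma1 gT G) <= 2.
Proof.
move=> nilG uniqG; apply: diam_leq => x y _.
have /setD1P[nx1 Gx] := valP x; have /setD1P[ny1 Gy] := valP y.
have [co_xy | not_co_xy] := boolP (coprime #[val x] #[val y]).
  have [xz yz] := coprime_cycleM nilG Gx Gy co_xy.
  apply: (proj2 (@Gamma1_walk G x y [:: val x * val y; val y] _ _ _)) => //=.
    by rewrite !inE (cycle_neq1 xz nx1) groupM // -in_setD1 (valP y).
  by rewrite /cycle_cmp xz yz orbT.
set d := gcdn #[val x] #[val y].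
have d_gt1 : 1 < d by rewrite ltn_neqAle eq_sym not_co_xy gcdn_gt0 order_gt0.
have pr_p := pdiv_prime d_gt1.
have [u ux ou] := prime_power pr_p (dvdn_trans (pdiv_dvd d) (dvdn_gcdl _ _)).
have [v vy ov] := prime_power pr_p (dvdn_trans (pdiv_dvd d) (dvdn_gcdr _ _)).
have Gu : u \in G by apply: subsetP ux; rewrite cycle_subG.
have Gv : v \in G by apply: subsetP vy; rewrite cycle_subG.
apply: (dist_common_power _ ux); first by apply: prime_order_neq1; rewrite ou.
by rewrite -cycle_subG (uniqG u v) ?ou ?cycle_subG.
Qed.

Lemma diam_Gamma1_pgroup G : p_group G -> diam (@Gamma1 gT G) <= 2.
Proof.
case/p_groupP=> p pr_p pG; apply: diam_leq => x y /connectP[s xs ->].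
have dvd_p (w : Gamma1_vertex G) : p %| #[val w].
  have /setD1P[nw1 Gw] := valP w.
  have p_w : p.-group <[val w]> := mem_p_elt pG Gw.
  by have [|] := pgroup_pdiv p_w; rewrite ?cycle_eq1.
have [u ux ou] := prime_power pr_p (dvd_p x).
have pr_u : prime #[u] by rewrite ou.
apply: (dist_common_power (prime_order_neq1 pr_u) ux).
(* Membership of [u] in the cyclic group of the current vertex passes along each edge, since [p]
   divides every vertex's order. *)
elim: s x xs ux => [|z s IHs] x //= /andP[xz zs] ux; apply: IHs zs _.
move: xz; rewrite Gamma1E => /andP[_ /orP[xz | zx]].
  by apply: subsetP ux; rewrite cycle_subG.
by apply: (prime_order_mem_cycle ux zx); rewrite ?ou.
Qed.

(** * Walks of length 4 when two primes divide the order *)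

Lemma other_prime_divisor G p :
  ~~ p_group G -> exists r, [/\ prime r, r != p & r %| #|G|].
Proof.
move=> npG; have : ~~ p.-group G by apply: contra npG; apply: pgroup_p.
rewrite /pgroup /pnat cardG_gt0 /= => /allPn[r].
by rewrite mem_primes => /and3P[pr_r _ rG] nrp; exists r.
Qed.

Lemma coprime_prime_walk G (x y : Gamma1_vertex G) p q :
    nilpotent G -> prime p -> prime q -> p != q ->
    p %| #[val x] -> q %| #[val y] ->
  connect (@Gamma1 gT G) x y /\ dist (@Gamma1 gT G) x y <= 4.
Proof.
move=> nilG pr_p pr_q npq px qy.
have /setD1P[_ Gx] := valP x; have /setD1P[_ Gy] := valP y.
have [u ux ou] := prime_power pr_p px; have [v vy ov] := prime_power pr_q qy.
have Gu : u \in G by apply: subsetP ux; rewrite cycle_subG.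
have Gv : v \in G by apply: subsetP vy; rewrite cycle_subG.
have nu1 : u != 1 by apply: prime_order_neq1; rewrite ou.
have nv1 : v != 1 by apply: prime_order_neq1; rewrite ov.
have [|uw vw] := coprime_cycleM nilG Gu Gv.
  by rewrite ou ov prime_coprime // dvdn_prime2.
apply: (@Gamma1_walk G x y [:: u; u * v; v; val y]) => //=.
  rewrite !inE nu1 nv1 Gu Gv groupM // (cycle_neq1 uw) //.
  by rewrite -in_setD1 (valP y).
by rewrite /cycle_cmp ux uw vw vy !orbT.
Qed.

Lemma Gamma1_walk4 G (x y : Gamma1_vertex G) :
    nilpotent G -> ~~ p_group G ->
  connect (@Gamma1 gT G) x y /\ dist (@Gamma1 gT G) x y <= 4.
Proof.
move=> nilG npG.
have /setD1P[nx1 Gx] := valP x; have /setD1P[ny1 Gy] := valP y.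
have pr_p := pdiv_order_prime nx1; have pr_q := pdiv_order_prime ny1.
have [eq_pq | npq] := eqVneq (pdiv #[val x]) (pdiv #[val y]); last first.
  exact: coprime_prime_walk nilG pr_p pr_q npq (pdiv_dvd _) (pdiv_dvd _).
have [r [pr_r nrp rG]] := other_prime_divisor (pdiv #[val x]) npG.
have [rx | nrx] := boolP (r %| #[val x]).
  by apply: coprime_prime_walk nilG pr_r pr_q _ rx (pdiv_dvd _); rewrite -eq_pq.
have [ry | nry] := boolP (r %| #[val y]).
  apply: coprime_prime_walk nilG pr_p pr_r _ (pdiv_dvd _) ry.
  by rewrite eq_sym.
(* Now [r] divides neither order, so [z] has order coprime to both and serves as the midpoint. *)
have [z Gz oz] := Cauchy pr_r rG.
have nz1 : z != 1 by apply: prime_order_neq1; rewrite oz.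
have [|zx xz] := coprime_cycleM nilG Gz Gx; first by rewrite oz prime_coprime.
have [|zy yz] := coprime_cycleM nilG Gz Gy; first by rewrite oz prime_coprime.
apply: (@Gamma1_walk G x y [:: z * val x; z; z * val y; val y]) => //=.
  rewrite !inE nz1 Gz !groupM // (cycle_neq1 zx) // (cycle_neq1 zy) //.
  by rewrite -in_setD1 (valP y).
by rewrite /cycle_cmp zx xz zy yz !orbT.
Qed.

Lemma dist_prime_order_gt3 G (x y : Gamma1_vertex G) :
    connect (@Gamma1 gT G) x y ->
    prime #[val x] -> #[val x] = #[val y] -> <[val x]> != <[val y]> ->
  3 < dist (@Gamma1 gT G) x y.
Proof.
move=> xy pr_x oxy neq_xy.
have pr_y : prime #[val y] by rewrite -oxy.
have neq1 (w : Gamma1_vertex G) : val w != 1 by have /setD1P[] := valP w.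
have edge (a b : Gamma1_vertex G) : Gamma1 a b -> cycle_cmp (val a) (val b).
  by rewrite Gamma1E => /andP[].
have cmp_refl (a : gT) : cycle_cmp a a by rewrite /cycle_cmp cycle_id.
(* Here [val x] lies in [<[val a]>] and [val y] in [<[val b]>]; the larger of these two cyclic
   groups contains both, so equal orders force equal subgroups. *)
have no_walk3 (a b : Gamma1_vertex G) :
    cycle_cmp (val x) (val a) -> cycle_cmp (val a) (val b) ->
  ~ cycle_cmp (val b) (val y).
- move=> xa ab; rewrite cycle_cmpC => yb.
  have {}xa := prime_order_neighbour pr_x (neq1 a) xa.
  have {}yb := prime_order_neighbour pr_y (neq1 b) yb.
  case/negP: neq_xy; apply/eqP; case/orP: ab => [ab | ba].
    apply: (@eq_cycle_order _ _ (val b)) => //.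
    by apply: subsetP xa; rewrite cycle_subG.
  apply: (@eq_cycle_order _ _ (val a)) => //.
  by apply: subsetP yb; rewrite cycle_subG.
have /has_path_of_lengthP[p [xp last_p _ <-]] := dist_path xy.
rewrite ltnNge; apply/negP => le3.
(* Paths of length 1 or 2 are padded to length 3 by repeating [x] at the start. *)
case: p xp last_p le3 => [|a [|b [|c [|//]]]] /=.
- by move=> _ eq_xy _; case/eqP: neq_xy; rewrite eq_xy.
- case/andP=> /edge xa _ eq_ay _; rewrite eq_ay in xa.
  exact: (no_walk3 x x).
- case/and3P=> /edge xa /edge ab _ eq_by _; rewrite eq_by in ab.
  exact: (no_walk3 x a).
case/and4P=> /edge xa /edge ab /edge bc _ eq_cy _; rewrite eq_cy in bc.
exact: (no_walk3 a b).
Qed.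

End PowerRelation.

Theorem theorem3p3 (gT : finGroupType) (G : {group gT}) :
  nilpotent G -> 2 < diam (@Gamma1 gT G) -> diam (@Gamma1 gT G) = 4.
Proof.
move=> nilG diam_gt2; apply/eqP; rewrite eqn_leq.
have npG : ~~ p_group G.
  by apply: contraL diam_gt2 => pG; rewrite -leqNgt diam_Gamma1_pgroup.
apply/andP; split.
  by apply: diam_leq => x y _; case: (Gamma1_walk4 x y nilG npG).
(* A boolean form, so that its failure yields explicit [u] and [v] for the lower bound. *)
pose uniq_primes := [forall u in G, forall v in G,
  prime #[u] ==> (#[u] == #[v]) ==> (<[u]> == <[v]>)].
have [/forall_inP uniqG | ] := boolP uniq_primes.
  case/idPn: diam_gt2; rewrite -leqNgt.
  apply: diam_Gamma1_unique_prime_subgroups => // u v Gu Gv pr_u ouv.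
  by have /forall_inP/(_ v Gv) := uniqG u Gu; rewrite pr_u ouv eqxx => /eqP.
case/forall_inPn=> u Gu /forall_inPn[v Gv].
rewrite !negb_imply => /and3P[pr_u /eqP ouv neq_uv].
have pr_v : prime #[v] by rewrite -ouv.
have Vu : u \in G^# by rewrite !inE prime_order_neq1.
have Vv : v \in G^# by rewrite !inE prime_order_neq1.
pose x : Gamma1_vertex G := Sub u Vu; pose y : Gamma1_vertex G := Sub v Vv.
have [xy _] := Gamma1_walk4 x y nilG npG.
exact: leq_trans (dist_prime_order_gt3 xy pr_u ouv neq_uv) (dist_leq_diam xy).
Qed.
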